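(* Let $r\ge 0$, $E_r=\mathbb Q[e_1,\ldots,e_{r+1}]$, and let $\mathbf u=(u_0,u_1,\ldots,u_r)$ be the universal fundamental system of solutions in $E_r[[t]]$ of $D^{r+1}y-e_1D^ry+\cdots+(-1)^{r+1}e_{r+1}y=0$ defined in the context. Then for every partition $\boldsymbol\lambda=(\lambda_0\ge\lambda_1\ge\cdots\ge\lambda_r\ge0)$, Giambelli's formula for Wronskians holds in $E_r[[t]]$: $$W_{\boldsymbol\lambda}(\mathbf u)=\Delta_{\boldsymbol\lambda}(\bar{\mathbf h})\cdot W_0(\mathbf u).$$
   Context: $e_1,\ldots,e_{r+1}$ are indeterminates over $\mathbb Q$, and $D=d/dt$ is the formal derivative of formal power series in $t$. The sequence $\bar{\mathbf h}=(h_0,h_1,h_2,\ldots)$ in $E_r$ is defined by $\sum_{n\ge0}h_nt^n=\dfrac{1}{1-e_1t+\cdots+(-1)^{r+1}e_{r+1}t^{r+1}}$, and $h_n=0$ for $n<0$. Let $U_{r+1}(D)=D^{r+1}-e_1D^r+\cdots+(-1)^{r+1}e_{r+1}$. Let $\mathbf x=(x_0,\ldots,x_r)$ and $\bar{\mathbf f}=(f_n)_{n\ge0}$ be further indeterminates, $f=\sum_{n\ge0}f_n\frac{t^n}{n!}$, and let $g\in E_r[\mathbf x,\bar{\mathbf f}][[t]]$ be the unique solution of the universal Cauchy problem $U_{r+1}(D)y=f$, $(D^iy)(0)=x_i$ for $0\le i\le r$, where $\phi(0)$ denotes the constant term of a power series $\phi$. For $0\le i\le r$ let $\psi_i\colon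 E_r[\mathbf x,\bar{\mathbf f}]\to E_r$ be the $E_r$-algebra homomorphism sending $\mathbf x\mapsto(\underbrace{0,\ldots,0}_{i},1,h_1,\ldots,h_{r-i})$ and $\bar{\mathbf f}\mapsto(0,0,\ldots)$, extended coefficientwise to power series. Then $u_i:=\psi_i(g)\in E_r[[t]]$. For a partition $\boldsymbol\lambda$, the generalized Wronskian $W_{\boldsymbol\lambda}(\mathbf u)$ is the determinant of the $(r+1)\times(r+1)$ matrix whose $j$-th row ($0\le j\le r$) is $(D^{j+\lambda_{r-j}}u_0,\ldots,D^{j+\lambda_{r-j}}u_r)$; $W_0(\mathbf u)=\det(D^ju_i)_{0\le i,j\le r}$ is the usual Wronskian. The Schur polynomial is $\Delta_{\boldsymbol\lambda}(\bar{\mathbf h})=\det(h_{i+\lambda_{r-i}-j})_{0\le i,j\le r}$. *)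

(* Defs.v *)
From HB Require Import structures.
From mathcomp Require Import all_boot all_algebra.
From mathcomp Require Import finmap boolp monalg mpoly.
Set Implicit Arguments.
Unset Strict Implicit.
Unset Printing Implicit Defensive.
Import GRing.Theory.
Local Open Scope ring_scope.

Record pseries (R : Type) := PSeries { pscoef : nat -> R }.

Notation "s .[[ n ]]" := (pscoef s n)
  (at level 2, left associativity, format "s .[[ n ]]") : ring_scope.

Lemma pseriesP (R : Type) (s u : pseries R) :
  (forall n, s.[[n]] = u.[[n]]) -> s = u.
Proof. by case: s u => [s] [u] /= /funext ->. Qed.

HB.instance Definition _ (R : Type) := gen_eqMixin (pseries R).
HB.instance Definition _ (R : Type) := gen_choiceMixin (pseries R).

Definition pseries_map (R S : Type) (f : R -> S) (s : pseries R) : pseries S :=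
  PSeries (fun n => f s.[[n]]).

Definition pseries_of_poly (R : nzRingType) (p : {poly R}) : pseries R :=
  PSeries (fun n => p`_n).

Section PSeriesZmod.
Variable R : zmodType.
Implicit Types s u : pseries R.

Definition ps_zero : pseries R := PSeries (fun=> 0).
Definition ps_opp s := PSeries (fun n => - s.[[n]]).
Definition ps_add s u := PSeries (fun n => s.[[n]] + u.[[n]]).

Fact ps_addA : associative ps_add.
Proof. by move=> s u v; apply: pseriesP => n /=; rewrite addrA. Qed.
Fact ps_addC : commutative ps_add.
Proof. by move=> s u; apply: pseriesP => n /=; rewrite addrC. Qed.
Fact ps_add0 : left_id ps_zero ps_add.
Proof. by move=> s; apply: pseriesP => n /=; rewrite add0r. Qed.
Fact ps_addN : left_inverse ps_zero ps_opp ps_add.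
Proof. by move=> s; apply: pseriesP => n /=; rewrite addNr. Qed.

HB.instance Definition _ :=
  GRing.isZmodule.Build (pseries R) ps_addA ps_addC ps_add0 ps_addN.

Lemma pscoef0 n : (0 : pseries R).[[n]] = 0. Proof. by []. Qed.
Lemma pscoefN s n : (- s).[[n]] = - s.[[n]]. Proof. by []. Qed.
Lemma pscoefD s u n : (s + u).[[n]] = s.[[n]] + u.[[n]]. Proof. by []. Qed.
Lemma pscoefB s u n : (s - u).[[n]] = s.[[n]] - u.[[n]]. Proof. by []. Qed.

Lemma pscoef_sum I (r : seq I) (P : pred I) (F : I -> pseries R) n :
  (\sum_(i <- r | P i) F i).[[n]] = \sum_(i <- r | P i) (F i).[[n]].
Proof. by elim/big_rec2: _ => // i x y _ <-. Qed.

Definition deriv_ps s : pseries R := PSeries (fun n => s.[[n.+1]] *+ n.+1).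

End PSeriesZmod.

Section PSeriesRing.
Variable R : comNzRingType.
Implicit Types s u : pseries R.

Definition ps_one : pseries R := PSeries (fun n => (n == 0%N)%:R).
Definition ps_mul s u : pseries R :=
  PSeries (fun n => \sum_(i < n.+1) s.[[i]] * u.[[n - i]]).
Definition ps_scale (a : R) s : pseries R := PSeries (fun n => a * s.[[n]]).

Let trunc n s : {poly R} := \poly_(i < n) s.[[i]].

Let ps_mulE n k s u :
  (k < n)%N -> (ps_mul s u).[[k]] = (trunc n s * trunc n u)`_k.
Proof.
move=> kn; rewrite coefM /=; apply: eq_bigr => i _.
by rewrite !coef_poly (leq_ltn_trans (leq_subr _ _) kn)
  (leq_ltn_trans _ kn) // -ltnS.
Qed.

Fact ps_mulC : commutative ps_mul.
Proof.
move=> s u; apply: pseriesP => n.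
by rewrite !(ps_mulE _ _ (ltnSn n)) mulrC.
Qed.

Fact ps_mulA : associative ps_mul.
Proof.
move=> s u v; apply: pseriesP => n.
rewrite !(ps_mulE _ _ (ltnSn n)).
transitivity (trunc n.+1 s * (trunc n.+1 u * trunc n.+1 v))`_n.
  rewrite !coefM; apply: eq_bigr => i _; congr (_ * _).
  have lt : (n - i < n.+1)%N by rewrite ltnS leq_subr.
  by rewrite coef_poly lt (ps_mulE _ _ lt).
rewrite mulrA !coefM; apply: eq_bigr => i _; congr (_ * _).
by rewrite [RHS]coef_poly ltn_ord (ps_mulE _ _ (ltn_ord i)).
Qed.

Fact ps_mul1 : left_id ps_one ps_mul.
Proof.
move=> s; apply: pseriesP => n /=.
rewrite big_ord_recl subn0 mul1r big1 ?addr0 // => i _.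
by rewrite mul0r.
Qed.

Fact ps_mulDl : left_distributive ps_mul +%R.
Proof.
move=> s u v; apply: pseriesP => n /=; rewrite -big_split /=.
by apply: eq_bigr => i _; rewrite mulrDl.
Qed.

Fact ps_one_neq0 : ps_one != 0.
Proof.
by apply/eqP => /(congr1 (fun s => s.[[0]])) /eqP; rewrite /= oner_eq0.
Qed.

HB.instance Definition _ := GRing.Zmodule_isComNzRing.Build (pseries R)
  ps_mulA ps_mulC ps_mul1 ps_mulDl ps_one_neq0.

Fact ps_scaleA a b s : ps_scale a (ps_scale b s) = ps_scale (a * b) s.
Proof. by apply: pseriesP => n /=; rewrite mulrA. Qed.
Fact ps_scale1 : left_id 1 ps_scale.
Proof. by move=> s; apply: pseriesP => n /=; rewrite mul1r. Qed.
Fact ps_scaleDr : right_distributive ps_scale +%R.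
Proof. by move=> a s u; apply: pseriesP => n /=; rewrite mulrDr. Qed.
Fact ps_scaleDl s : {morph ps_scale^~ s : a b / a + b}.
Proof. by move=> a b; apply: pseriesP => n /=; rewrite mulrDl. Qed.

HB.instance Definition _ := GRing.Zmodule_isLmodule.Build R (pseries R)
  ps_scaleA ps_scale1 ps_scaleDr ps_scaleDl.

Fact ps_scaleAl (a : R) s u : a *: (s * u) = (a *: s) * u.
Proof.
apply: pseriesP => n /=; rewrite big_distrr /=.
by apply: eq_bigr => i _; rewrite mulrA.
Qed.

HB.instance Definition _ := GRing.Lmodule_isLalgebra.Build R (pseries R)
  ps_scaleAl.
HB.instance Definition _ := GRing.Lalgebra_isComAlgebra.Build R (pseries R).

Definition ps_unit : pred (pseries R) := fun s => `[< exists u, u * s = 1 >].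

Definition ps_inv s : pseries R :=
  if pselect (exists u, u * s = 1) is left e then sval (cid e) else s.

Fact ps_mulVr : {in ps_unit, left_inverse 1 ps_inv *%R}.
Proof.
move=> s /asboolP us; rewrite /ps_inv; case: pselect => // e.
exact: svalP (cid e).
Qed.

Fact ps_unitP s u : u * s = 1 -> ps_unit s.
Proof. by move=> us; apply/asboolP; exists u. Qed.

Fact ps_inv_out : {in [predC ps_unit], ps_inv =1 id}.
Proof.
move=> s /asboolPn us; rewrite /ps_inv.
by case: pselect.
Qed.

HB.instance Definition _ := GRing.ComNzRing_hasMulInverse.Build (pseries R)
  ps_mulVr ps_unitP ps_inv_out.

Lemma pscoef1 n : (1 : pseries R).[[n]] = (n == 0%N)%:R. Proof. by []. Qed.
Lemma pscoefM s u n :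
  (s * u).[[n]] = \sum_(i < n.+1) s.[[i]] * u.[[n - i]].
Proof. by []. Qed.
Lemma pscoefZ a s n : (a *: s).[[n]] = a * s.[[n]]. Proof. by []. Qed.

End PSeriesRing.

Lemma causal_rec (T : Type) (x0 : T) (F : nat -> (nat -> T) -> T) :
    (forall n a b, (forall m, (m < n)%N -> a m = b m) -> F n a = F n b) ->
  exists a, forall n, a n = F n a.
Proof.
move=> Fc; pose G := fix G k := if k is k'.+1 then fun m => F m (G k') else
  fun=> x0.
have GS k m : G k.+1 m = F m (G k) by [].
have stable m k : (m < k)%N -> G k m = G m.+1 m.
  elim/ltn_ind: m k => m IH [|k] // mk; rewrite !GS; apply: Fc => i im.
  by rewrite (IH _ im _ (leq_trans im mk)) (IH _ im _ im).
exists (fun n => G n.+1 n) => n; rewrite GS; apply: Fc => m mn.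
exact: stable.
Qed.

Lemma ps_unit_coef0 (R : comNzRingType) (s : pseries R) :
  s.[[0]] = 1 -> s \is a GRing.unit.
Proof.
move=> s0.
pose F n (a : nat -> R) : R :=
  (n == 0%N)%:R - \sum_(i < n) s.[[i.+1]] * a (n - i.+1)%N.
have [|a aE] := @causal_rec R 0 F.
  move=> n a b ab; rewrite /F; congr (_ - _); apply: eq_bigr => i _.
  by rewrite ab // ltn_subrL /= (leq_ltn_trans _ (ltn_ord i)).
apply/unitrPr; exists (PSeries a); apply: pseriesP => n.
rewrite pscoefM big_ord_recl s0 mul1r subn0 /= [a n]aE /F.
by rewrite addrNK.
Qed.

(* E_r; its indeterminate e_{k+1} is 'X_k for k : 'I_r.+1. *)
Notation Ering r := (mpoly r.+1 rat).

(* E_r[x, f]; the monomial variables inl i and inr n are x_i and f_n. *)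
Notation XFring r := {malg (mpoly r.+1 rat)[{cmonom ('I_r.+1 + nat)%type}]}.

Section Universal.
Variable r : nat.

Definition varx (i : 'I_r.+1) : XFring r := << ucm (inl i) >>.
Definition varf (n : nat) : XFring r := << ucm (inr n) >>.

Definition epoly : {poly Ering r} :=
  1 + \sum_(k < r.+1) ((-1) ^+ k.+1 * 'X_k) *: 'X^(k.+1).

Lemma epoly_unit : pseries_of_poly epoly \is a GRing.unit.
Proof.
apply: ps_unit_coef0; rewrite /= coefD coef1 coef_sum big1 ?addr0 // => k _.
by rewrite coefZ coefXn mulr0.
Qed.

Definition hseries : pseries (Ering r) := (pseries_of_poly epoly)^-1.

Definition hseq (n : int) : Ering r := if n is Posz m then hseries.[[m]] else 0.

Definition U_D (A : comAlgType (Ering r)) (y : pseries A) : pseries A :=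
  iter r.+1 (@deriv_ps A) y +
  \sum_(k < r.+1) ((-1) ^+ k.+1 * 'X_k : Ering r)%:A
    *: iter (r - k) (@deriv_ps A) y.

Definition fseries : pseries (XFring r) :=
  PSeries (fun n => ((n`!%:R)^-1 : rat)%:MP_[r.+1] *: varf n).

Definition universal_cauchy (y : pseries (XFring r)) : Prop :=
  U_D y = fseries /\
  forall i : 'I_r.+1, (iter i (@deriv_ps (XFring r)) y).[[0]] = varx i.


Let q n : Ering r := ((n`!%:R)^-1 : rat)%:MP_[r.+1].

Let qS n : q n.+1 * n.+1%:R = q n.
Proof.
rewrite /q -mpolyC_nat -mpolyCM; congr (_%:MP_[r.+1]).
have n0 : n.+1%:R != 0 :> rat by rewrite Num.Theory.pnatr_eq0.
by rewrite factS natrM invfM mulrAC mulVf // mul1r.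
Qed.

Let qK n : q n * n`!%:R = 1.
Proof.
rewrite /q -mpolyC_nat -mpolyCM mulVf ?mpolyC1 //.
by rewrite Num.Theory.pnatr_eq0 -lt0n fact_gt0.
Qed.

Let egf (c : nat -> XFring r) : pseries (XFring r) :=
  PSeries (fun n => q n *: c n).

Let egf_surj y : {c | y = egf c}.
Proof.
exists (fun n => n`!%:R *: y.[[n]]); apply: pseriesP => n /=.
by rewrite scalerA qK scale1r.
Qed.

Let egf_inj c d : egf c = egf d -> c =1 d.
Proof.
have K n (a : XFring r) : (n`!%:R : Ering r) *: (q n *: a) = a.
  by rewrite scalerA mulrC qK scale1r.
move=> cd n; rewrite -[c n](K n) -[d n](K n).
by have /= -> := congr1 (fun y => y.[[n]]) cd.
Qed.

Let egf_deriv i c :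
  iter i (@deriv_ps (XFring r)) (egf c) = egf (fun n => c (n + i)%N).
Proof.
elim: i => [|i IH]; first by apply: pseriesP => n /=; rewrite addn0.
rewrite iterS IH; apply: pseriesP => n /=.
by rewrite -scaler_nat scalerA mulrC qS addnS.
Qed.

Let egf_coef0 c : (egf c).[[0]] = c 0%N.
Proof. by rewrite /= -[q 0]mulr1 (qK 0) scale1r. Qed.

Let U_D_egf c : U_D (egf c) = egf (fun n => c (n + r.+1)%N +
  \sum_(k < r.+1) ((-1) ^+ k.+1 * 'X_k : Ering r) *: c (n + (r - k))%N).
Proof.
rewrite /U_D egf_deriv; apply: pseriesP => n.
rewrite pscoefD pscoef_sum /= scalerDr scaler_sumr; congr (_ + _).
apply: eq_bigr => k _; rewrite egf_deriv /= -scalerAl mul1r.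
by rewrite [LHS]scalerA [RHS]scalerA mulrC.
Qed.

Lemma universal_cauchyP :
  exists g, universal_cauchy g /\ forall y, universal_cauchy y -> y = g.
Proof.
pose S n (c : nat -> XFring r) :=
  \sum_(k < r.+1) ((-1) ^+ k.+1 * 'X_k : Ering r) *: c (n + (r - k))%N.
pose F n c := if (n < r.+1)%N then varx (inord n)
  else varf (n - r.+1)%N - S (n - r.+1)%N c.
have Fc n a b : (forall m, (m < n)%N -> a m = b m) -> F n a = F n b.
  move=> ab; rewrite /F; case: ltnP => [//|rn].
  suff -> : S (n - r.+1)%N a = S (n - r.+1)%N b by [].
  apply: eq_bigr => k _; rewrite ab //.
  by rewrite -[X in (_ < X)%N](subnK rn) ltn_add2l ltnS leq_subr.
have cauchyE c : universal_cauchy (egf c) <-> forall n, c n = F n c.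
  rewrite /universal_cauchy U_D_egf; split=> [[eqf ini] n | cF].
    rewrite /F; case: ltnP => [nr | rn].
      by have := ini (Ordinal nr); rewrite egf_deriv egf_coef0 => ->;
        congr varx; apply: val_inj; rewrite /= inordK.
    have E : c n + S (n - r.+1)%N c = varf (n - r.+1)%N.
      by have := @egf_inj _ varf eqf (n - r.+1)%N; rewrite (subnK rn).
    by rewrite -E addrK.
  split=> [|i]; last first.
    by rewrite egf_deriv egf_coef0 cF /F ltn_ord inord_val.
  have E n : c (n + r.+1)%N + S n c = varf n.
    by rewrite cF /F ltnNge leq_addl /= addnK subrK.
  by apply: pseriesP => n; rewrite [RHS]/= -E.
have [c cF] := causal_rec 0 Fc.
exists (egf c); split=> [|y]; first exact/cauchyE.
have [d ->] := egf_surj y; move=> /cauchyE dF.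
suff cd n : d n = c n by apply: pseriesP => n /=; rewrite cd.
by elim/ltn_ind: n => n IH; rewrite cF dF; apply: Fc.
Qed.

Definition universal_solution : pseries (XFring r) :=
  sval (cid universal_cauchyP).

Lemma universal_solutionP : universal_cauchy universal_solution.
Proof. exact: (svalP (cid universal_cauchyP)).1. Qed.

Lemma universal_solution_unique y :
  universal_cauchy y -> y = universal_solution.
Proof. exact: (svalP (cid universal_cauchyP)).2. Qed.

End Universal.

Section MonomialEval.
Variables (I : choiceType) (R : comNzRingType) (v : I -> R).

Definition cmeval (m : {cmonom I}) : R := \prod_(k <- finsupp m) v k ^+ m k.

Let cmevalEw (m : {cmonom I}) (d : {fset I}) :
  (finsupp m `<=` d)%fset -> cmeval m = \prod_(k <- d) v k ^+ m k.
Proof.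
move=> le; rewrite /cmeval (big_fset_incl _ le) //= => k _.
by rewrite -cmE_eq0 => /eqP ->.
Qed.

Fact cmeval_is_multiplicative : mmorphism cmeval.
Proof.
split=> [m1 m2|]; last by rewrite /cmeval mdom1 big_seq_fset0.
rewrite (@cmevalEw m1 (finsupp m1 `|` finsupp m2)%fset) ?fsubsetUl //.
rewrite (@cmevalEw m2 (finsupp m1 `|` finsupp m2)%fset) ?fsubsetUr //.
rewrite /cmeval mdomD -big_split /=.
by apply: eq_bigr => k _; rewrite cmM exprD.
Qed.

HB.instance Definition _ := monalg.isMultiplicative.Build {cmonom I} R cmeval
  cmeval_is_multiplicative.

Lemma cmevalU k : cmeval (ucm k) = v k.
Proof. by rewrite /cmeval mdomU big_seq_fset1 cmUU expr1. Qed.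

End MonomialEval.

Section FundamentalSystem.
Variable r : nat.

Definition psi_point (i : 'I_r.+1) (z : 'I_r.+1 + nat) : Ering r :=
  match z with
  | inl j => if (j < i)%N then 0 else if j == i then 1 else hseq r (j - i)%N
  | inr _ => 0
  end.

Definition psi (i : 'I_r.+1) : {lrmorphism XFring r -> Ering r | *%R} :=
  monalg.mmap idfun (cmeval (psi_point i)).

Lemma psi_varx i j : psi i (varx j) = psi_point i (inl j).
Proof. by rewrite /psi /varx /= monalg.mmapU mul1r cmevalU. Qed.

Lemma psi_varf i n : psi i (varf r n) = 0.
Proof. by rewrite /psi /varf /= monalg.mmapU mul1r cmevalU. Qed.

Definition usol (i : 'I_r.+1) : pseries (Ering r) :=
  pseries_map (psi i) (universal_solution r).

End FundamentalSystem.

Section Determinants.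
Variables (R : comNzRingType) (r : nat).

Definition wronskian (u : 'I_r.+1 -> pseries R) : pseries R :=
  \det (\matrix_(j, i) iter j (@deriv_ps R) (u i)).

(* rev_ord j is r - j. *)
Definition gen_wronskian (lam : r.+1.-tuple nat) (u : 'I_r.+1 -> pseries R) :
    pseries R :=
  \det (\matrix_(j, i) iter (j + tnth lam (rev_ord j)) (@deriv_ps R) (u i)).

Definition schur (lam : r.+1.-tuple nat) (h : int -> R) : R :=
  \det (\matrix_(i < r.+1, j < r.+1)
          h ((i + tnth lam (rev_ord i))%N%:Z - j%:Z)).

End Determinants.

(* Main.v *)
Require Import Defs.
From mathcomp Require Import all_boot all_algebra.
From mathcomp Require Import finmap boolp monalg mpoly.
Local Open Scope ring_scope.

(** The identity is linear algebra over the coefficient ring. Modulo a monic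
    linear differential equation of order [r+1] with constant coefficients,
    every [D^n] is a linear combination of [1, D, ..., D^r], with coefficients
    that do not depend on the solution it is applied to
    ([iter_deriv_ps_reduce]). So the matrix of a generalized Wronskian of
    solutions is [C *m M], where [M] is the matrix of the usual Wronskian and
    [C] has constant entries; hence [W_lam = \det C *: W_0].

    The scalar [\det C] is found by evaluating the relation between the two
    matrices at [t = 0]: it is the determinant of the initial values of the
    generalized Wronskian as soon as those of the usual one have determinant 1
    ([gen_wronskian_initial]). For the universal system, [(D^n u_i)(0)] and
    [h_(n-i)] obey the same recurrence with the same first values, so they
    agree for all [n] ([usol_initial]). Thus [M] at [t = 0] is the unitriangular
    matrix [(h_(j-i))], and the initial values of the generalized Wronskian form
    the matrix whose determinant is the Schur polynomial. *)

Import GRing.Theory.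

(** * Solutions of a linear equation with constant coefficients *)

Lemma iter_deriv_ps_lincomb (R : comNzRingType) (I : finType)
    (a : I -> R) (s : I -> pseries R) n :
  iter n (@deriv_ps R) (\sum_k a k *: s k)
  = \sum_k a k *: iter n (@deriv_ps R) (s k).
Proof.
elim: n => // n IHn; rewrite iterS IHn; apply: pseriesP => m.
rewrite [LHS]/= !pscoef_sum -sumrMnl; apply: eq_bigr => k _.
by rewrite !pscoefZ /= mulrnAr.
Qed.

Lemma iter_deriv_ps_map (R S : zmodType) (f : {additive R -> S})
    (s : pseries R) n :
  iter n (@deriv_ps S) (pseries_map f s)
  = pseries_map f (iter n (@deriv_ps R) s).
Proof.
by elim: n => // n IHn; rewrite iterS IHn; apply: pseriesP => m /=;
  rewrite raddfMn.
Qed.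

Section ConstantCoefficients.
Variables (R : comNzRingType) (r : nat) (a : 'I_r.+1 -> R).
Variable u : 'I_r.+1 -> pseries R.

Hypothesis u_ode : forall i,
  iter r.+1 (@deriv_ps R) (u i)
  = \sum_(k < r.+1) a k *: iter (r - k) (@deriv_ps R) (u i).

(** The coefficients [c] are those of the remainder of [D^n] by the
    characteristic polynomial, whence their independence of [i]. *)
Lemma iter_deriv_ps_reduce n : exists c : 'I_r.+1 -> R, forall i,
  iter n (@deriv_ps R) (u i)
  = \sum_(k < r.+1) c k *: iter k (@deriv_ps R) (u i).
Proof.
elim/ltn_ind: n => n IHn; case: (ltnP n r.+1) => [n_le_r | r_lt_n].
  (* [D^n] is its own remainder. *)
  exists (fun k => (k == Ordinal n_le_r)%:R) => i.
  rewrite (bigD1 (Ordinal n_le_r)) //= eqxx scale1r big1 ?addr0 // => k.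
  by move/negPf->; rewrite scale0r.
(* The equation lowers the order of [D^n = D^(n - r - 1) D^(r+1)]. *)
have lower (k : 'I_r.+1) : (n - r.+1 + (r - k) < n)%N.
  by rewrite -[X in (_ < X)%N](subnK r_lt_n) ltn_add2l ltnS leq_subr.
have [c cE] := fin_all_exists (fun k => IHn _ (lower k)).
exists (fun l => \sum_k a k * c k l) => i.
rewrite -(subnK r_lt_n) iterD u_ode iter_deriv_ps_lincomb.
under eq_bigr => k _ do rewrite -iterD cE scaler_sumr.
rewrite exchange_big; apply: eq_bigr => l _; rewrite scaler_suml.
by apply: eq_bigr => k _; rewrite scalerA.
Qed.

(** Both sides are the same constant multiple of the Wronskian, and that
    constant can be read off at [t = 0]. *)
Lemma gen_wronskian_initial (lam : r.+1.-tuple nat) :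
    \det (\matrix_(j, i) (iter j (@deriv_ps R) (u i)).[[0]]) = 1 ->
  gen_wronskian lam u
  = \det (\matrix_(j < r.+1, i < r.+1)
            (iter (j + tnth lam (rev_ord j)) (@deriv_ps R) (u i)).[[0]])
    *: wronskian u.
Proof.
move=> det_init.
have [c cE] := fin_all_exists
  (fun j : 'I_r.+1 => iter_deriv_ps_reduce (j + tnth lam (rev_ord j))).
pose C := \matrix_(j, k) c j k.
have -> : gen_wronskian lam u = \det C *: wronskian u.
  rewrite -mulr_algl -[(\det C)%:A]/(in_alg _ (\det C)) -det_map_mx.
  rewrite /wronskian -det_mulmx; congr (\det _).
  apply/matrixP => j i; rewrite !mxE cE; apply: eq_bigr => k _.
  by rewrite !mxE /= mulr_algl.
congr (_ *: _); rewrite -[LHS]mulr1 -det_init -det_mulmx; congr (\det _).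
apply/matrixP => j i; rewrite !mxE cE pscoef_sum; apply: eq_bigr => k _.
by rewrite !mxE pscoefZ.
Qed.

End ConstantCoefficients.

(** * The universal fundamental system *)

Section UniversalSystem.
Variable r : nat.

(** The coefficients of the equation solved for its leading term,
    [D^(r+1) y = \sum_k ecoef k *: D^(r-k) y]. *)
Definition ecoef (k : 'I_r.+1) : Ering r := - ((-1) ^+ k.+1 * 'X_k).

Lemma epoly_coef n :
  (epoly r)`_n = (n == 0)%:R - \sum_(k < r.+1) ecoef k * (n == k.+1)%:R.
Proof.
rewrite /epoly coefD coef1 coef_sum -sumrN; congr (_ + _).
by apply: eq_bigr => k _; rewrite coefZ coefXn /ecoef mulNr opprK.
Qed.

(** Comparison of the coefficients of [t^n] in [epoly * hseries = 1]; the
    subtraction of naturals is truncated, so the terms with [k >= n] have to be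
    excluded. *)
Lemma hseries_coef n :
  (hseries r).[[n]]
  = (n == 0)%:R
    + \sum_(k < r.+1) ecoef k * (if (k < n)%N then (hseries r).[[n - k.+1]] else 0).
Proof.
have := congr1 (fun s => s.[[n]]) (mulrV (epoly_unit r)).
rewrite pscoefM pscoef1 -/(hseries r) => <-.
under eq_bigr => i _ do rewrite [pscoef _ _]/= epoly_coef mulrBl mulr_suml.
rewrite sumrB exchange_big big_ord_recl mul1r subn0 big1 ?addr0; last first.
  by move=> i _; rewrite mul0r.
apply/esym; rewrite -addrA addrC -[RHS]add0r; congr (_ + _).
rewrite addrC -sumrB big1 // => k _; apply/eqP; rewrite subr_eq0; apply/eqP.
case: ltnP => [k_lt_n | n_le_k].
  rewrite (bigD1 (Ordinal (k_lt_n : (k.+1 < n.+1)%N))) //= eqxx mulr1.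
  rewrite big1 ?addr0 // => i; rewrite -val_eqE /= => /negPf->.
  by rewrite mulr0 mul0r.
rewrite mulr0 big1 // => i _.
by rewrite ltn_eqF ?mulr0 ?mul0r // ltnS (leq_trans _ n_le_k) // -ltnS.
Qed.

Lemma hseq0 : hseq r 0 = 1.
Proof.
rewrite /= hseries_coef eqxx big1 ?addr0 // => k _.
by rewrite mulr0.
Qed.

Lemma hseq_subn_lt m n : (m < n)%N -> hseq r (m%:Z - n%:Z) = 0.
Proof.
by move=> m_lt_n; rewrite -opprB subzn 1?ltnW //; case: (n - m)%N (subn_gt0 m n);
  rewrite ?m_lt_n.
Qed.

Lemma hseq_rec (n : nat) :
  hseq r n.+1 = \sum_(k < r.+1) ecoef k * hseq r (n%:Z - k%:Z).
Proof.
rewrite [LHS]/= hseries_coef add0r; apply: eq_bigr => k _; congr (_ * _).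
case: ltnP => [k_le_n | n_lt_k]; last by rewrite hseq_subn_lt.
by rewrite subSS subzn.
Qed.

(** The forcing term of the universal problem is killed by [psi], which commutes
    with [D] and with the scalars of the equation. *)
Lemma usol_ode i :
  iter r.+1 (@deriv_ps _) (usol i)
  = \sum_(k < r.+1) ecoef k *: iter (r - k) (@deriv_ps _) (usol i).
Proof.
have [ode _] := universal_solutionP r.
apply: pseriesP => n; rewrite pscoef_sum /usol iter_deriv_ps_map.
have : psi i (U_D (universal_solution r)).[[n]] = 0.
  by rewrite ode linearZ /= psi_varf mulr0.
rewrite /U_D pscoefD pscoef_sum raddfD raddf_sum => /eqP.
rewrite addr_eq0 => /eqP lead; rewrite [LHS]lead -sumrN.
apply: eq_bigr => k _; rewrite iter_deriv_ps_map.
rewrite pscoefZ mulr_algl pscoefZ /ecoef mulNr; congr (- _).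
exact: linearZ.
Qed.

(** Both sides satisfy the recurrence given by the equation; on the right this
    needs [n - i >= 1], which the range [n > r >= i] guarantees, and the values
    for [n <= r] are those prescribed by the specialization [psi]. *)
Lemma usol_initial (i : 'I_r.+1) n :
  (iter n (@deriv_ps _) (usol i)).[[0]] = hseq r (n%:Z - i%:Z).
Proof.
elim/ltn_ind: n => n IHn; case: (ltnP n r.+1) => [n_le_r | r_lt_n].
  have [_ init] := universal_solutionP r.
  rewrite /usol iter_deriv_ps_map /= (init (Ordinal n_le_r)) psi_varx /=.
  case: ltnP => [/hseq_subn_lt -> // | i_le_n].
  case: eqP => [<- | _]; first by rewrite subrr hseq0.
  by rewrite subzn.
have i_lt_n : (i < n)%N := leq_trans (ltn_ord i) r_lt_n.
rewrite -{1}(subnK r_lt_n) iterD usol_ode iter_deriv_ps_lincomb.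
rewrite subzn 1?ltnW //; have [m mE] : exists m, (n - i = m.+1)%N.
  by exists (n - i).-1; rewrite prednK ?subn_gt0.
rewrite mE hseq_rec pscoef_sum; apply: eq_bigr => k _.
have k_le_r : (k <= r)%N by rewrite -ltnS.
have shiftE : (n - r.+1 + (r - k) + k.+1 = n)%N.
  by rewrite -addnA addnS subnK // subnK.
rewrite pscoefZ -iterD IHn; last first.
  by rewrite -[X in (_ < X)%N]shiftE addnS ltnS leq_addr.
congr (_ * hseq r _); apply/eqP; rewrite subr_eq addrAC eq_sym subr_eq.
rewrite -!PoszD eqz_nat -eqSS -addSn -mE subnK 1?ltnW //.
by rewrite -addnS shiftE.
Qed.

Lemma usol_initial_det :
  \det (\matrix_(j, i) (iter j (@deriv_ps _) (@usol r i)).[[0]]) = 1.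
Proof.
rewrite det_trig; last first.
  by apply/is_trig_mxP => j i j_lt_i; rewrite mxE usol_initial hseq_subn_lt.
by rewrite big1 // => i _; rewrite mxE usol_initial subrr hseq0.
Qed.

End UniversalSystem.

Theorem proposition8p10 (r : nat) (lam : r.+1.-tuple nat)
    (hlam : sorted geq lam) :
  gen_wronskian lam (@usol r) = schur lam (hseq r) *: wronskian (@usol r).
Proof.
rewrite (gen_wronskian_initial _ _ _ _ (usol_ode r) lam (usol_initial_det r)).
rewrite /schur; under eq_mx => j i do rewrite usol_initial.
by [].
Qed.
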